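(* Let $R$ be an integral domain and $M$ a nonzero unital $R$-module. Then $M$ is a uniserial module if and only if $m\mid n$ or $n\mid m$ for every $m,n\in M^{\#}$.
   Context: For $m,n\in M$ write $m\mid n$ if $n=rm$ for some $r\in R$ (equivalently $Rn\subseteq Rm$). $M^{\#}=\{0\neq m\in M: Rm\neq M\}$ is the set of nonzero nongenerators of $M$. An $R$-module is uniserial if any two of its submodules are comparable under inclusion. *)

(* Defs.v *)
From HB Require Import structures.
From mathcomp Require Import all_boot all_algebra.
From mathcomp Require Import boolp classical_sets.

Set Implicit Arguments.
Unset Strict Implicit.
Unset Printing Implicit Defensive.

Import GRing.Theory.
Local Open Scope classical_set_scope.
Local Open Scope ring_scope.

(* The library's [GRing.submod_closed] is about boolean predicates; [mem N]
   is the (classical) boolean membership predicate of an arbitrary set [N]. *)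
Definition is_submodule (R : idomainType) (M : lmodType R) (N : set M) : Prop :=
  GRing.submod_closed (mem N).

Definition uniserial (R : idomainType) (M : lmodType R) : Prop :=
  forall N L : set M, is_submodule N -> is_submodule L -> N `<=` L \/ L `<=` N.

Definition mdvd (R : idomainType) (M : lmodType R) (m n : M) : Prop :=
  exists r : R, n = r *: m.

Definition cyclic_submodule (R : idomainType) (M : lmodType R) (m : M) : set M :=
  range (fun r : R => r *: m).

(* The set written M^# : nonzero elements that do not generate M. *)
Definition nonzero_nongenerators (R : idomainType) (M : lmodType R) : set M :=
  [set m : M | m <> 0 /\ cyclic_submodule m <> setT].

Arguments uniserial {R} M.
Arguments nonzero_nongenerators {R} M _.

(* Main.v *)
Require Import Defs.
From HB Require Import structures.
From mathcomp Require Import all_boot all_algebra.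
From mathcomp Require Import boolp classical_sets.

Set Implicit Arguments.
Unset Strict Implicit.
Unset Printing Implicit Defensive.

Import GRing.Theory.
Local Open Scope classical_set_scope.
Local Open Scope ring_scope.

(** Divisibility is reverse inclusion of cyclic submodules, so uniseriality makes any two elements
    comparable. Conversely, zero and generators are comparable with everything
    ([not_nonzero_nongenerator]), so the hypothesis on $M^{\#}$ extends to all of $M$. If two
    submodules were incomparable, an element of each outside the other would give a pair neither of
    which divides the other. *)

Lemma submoduleZ (R : idomainType) (M : lmodType R) (N : set M) (r : R) (m : M) :
  is_submodule N -> N m -> N (r *: m).
Proof.
case=> N0 Nlin Nm; apply: set_mem; rewrite -[r *: m]addr0.
by apply: Nlin => //; apply: mem_set.
Qed.

Lemma cyclic_is_submodule (R : idomainType) (M : lmodType R) (m : M) :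
  is_submodule (cyclic_submodule m).
Proof.
split=> [|a u v /set_mem[r _ <-] /set_mem[s _ <-]]; apply: mem_set.
  by exists 0; rewrite ?scale0r.
by exists (a * r + s) => //; rewrite scalerDl scalerA.
Qed.

Lemma cyclic_subset_mdvd (R : idomainType) (M : lmodType R) (m n : M) :
  cyclic_submodule n `<=` cyclic_submodule m -> mdvd m n.
Proof.
move=> /(_ n)[|r _ <-]; last by exists r.
by exists 1; rewrite ?scale1r.
Qed.

(** Every [n] divides [0], with coefficient [0], and a generator divides every element. *)
Lemma not_nonzero_nongenerator (R : idomainType) (M : lmodType R) (m n : M) :
  ~ nonzero_nongenerators M m -> mdvd m n \/ mdvd n m.
Proof.
move=> /not_andP[/contrapT->|/contrapT genm].
  by right; exists 0; rewrite scale0r.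
by left; have [] : cyclic_submodule m n by [rewrite genm|]; move=> r _ <-; exists r.
Qed.

Theorem lemma2 (R : idomainType) (M : lmodType R)
    (M_nonzero : exists x : M, x <> 0) :
  uniserial M <->
  (forall m n : M, nonzero_nongenerators M m -> nonzero_nongenerators M n ->
     mdvd m n \/ mdvd n m).
Proof.
split=> [uM m n _ _|dvdM N L subN subL].
  have [/cyclic_subset_mdvd|/cyclic_subset_mdvd] :=
    uM _ _ (cyclic_is_submodule m) (cyclic_is_submodule n); first by right.
  by left.
have dvd_total (m n : M) : mdvd m n \/ mdvd n m.
  have [nzm|/not_nonzero_nongenerator//] := pselect (nonzero_nongenerators M m).
  have [nzn|] := pselect (nonzero_nongenerators M n); first exact: dvdM.
  move=> nnn; apply: (iffLR (or_comm _ _)); exact: not_nonzero_nongenerator.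
(* Witnesses of incomparability: [x] in [N] but not in [L], then [y] in [L] but not in [N].
   Whichever divides the other drags it into its own submodule. *)
apply: contrapT => /not_orP[] /existsNP[x /not_implyP[Nx nLx]].
move=> /existsNP[y /not_implyP[Ly nNy]].
have [[r yE]|[r xE]] := dvd_total x y.
  by apply: nNy; rewrite yE; apply: submoduleZ.
by apply: nLx; rewrite xE; apply: submoduleZ.
Qed.
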